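(* There is a universal constant $c>0$ such that for all positive integers $n,m$ and every Boolean function $f:\{0,1\}^m\to\{0,1\}$, $$\widetilde{\deg}(\mathsf{OR}_n\circ f)\ \ge\ c\,\sqrt{n}\;\widetilde{\deg}(f).$$
   Context: For a Boolean function $h:\{0,1\}^N\to\{0,1\}$, the approximate degree $\widetilde{\deg}(h)$ is the minimum degree of a real polynomial $p$ in $x_1,\dots,x_N$ such that $|h(x)-p(x)|\le 1/3$ for all $x\in\{0,1\}^N$. $\mathsf{OR}_n:\{0,1\}^n\to\{0,1\}$ is $0$ on the all-zeros string and $1$ elsewhere. For $g:\{0,1\}^n\to\{0,1\}$ and $f:\{0,1\}^m\to\{0,1\}$, the composition $g\circ f:\{0,1\}^{nm}\to\{0,1\}$ is $(g\circ f)(x_1,\dots,x_n)=g(f(x_1),\dots,f(x_n))$ with $x_i\in\{0,1\}^m$. *)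

(* Defs.v *)
From mathcomp Require Import all_boot all_order all_algebra.
From mathcomp Require Import boolp reals.
From mathcomp Require Import mpoly.

Set Implicit Arguments.
Unset Strict Implicit.
Unset Printing Implicit Defensive.

Import Order.TTheory GRing.Theory Num.Theory.
Local Open Scope ring_scope.

Definition cube (N : nat) : finType := {ffun 'I_N -> bool}.

Definition boolean_fun (N : nat) : Type := cube N -> bool.

Definition OR (n : nat) : boolean_fun n := fun x => x != [ffun=> false].

(* The n * m input bits are listed row by row: bit j of the i-th block of length
   m sits at position mxvec_index i j. *)
Definition block (n m : nat) (x : cube (n * m)) (i : 'I_n) : cube m :=
  [ffun j => x (mxvec_index i j)].

Definition bcomp (n m : nat) (g : boolean_fun n) (f : boolean_fun m) :
    boolean_fun (n * m) :=
  fun x => g [ffun i => f (block x i)].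

Definition cube_eval (R : realType) (N : nat) (p : {mpoly R[N]}) (x : cube N) :
    R :=
  p.@[fun i => (x i)%:R].

Definition approximates (R : realType) (N : nat) (p : {mpoly R[N]})
    (h : boolean_fun N) : Prop :=
  forall x : cube N, `|(h x)%:R - cube_eval p x| <= 1 / 3.

(* msize is the total degree plus one, and 0 for the zero polynomial, which is
   thus given degree 0. *)
Definition has_approx_of_degree (R : realType) (N : nat) (h : boolean_fun N)
    (d : nat) : Prop :=
  exists p : {mpoly R[N]}, (msize p).-1 = d /\ approximates p h.

Definition interpolant (R : realType) (N : nat) (h : boolean_fun N) :
    {mpoly R[N]} :=
  \sum_(a : cube N | h a) \prod_(i < N) (if a i then 'X_i else 1 - 'X_i).

Lemma interpolantE (R : realType) (N : nat) (h : boolean_fun N) (x : cube N) :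
  cube_eval (interpolant R h) x = (h x)%:R.
Proof.
rewrite /cube_eval /interpolant rmorph_sum /=.
have E (a : cube N) :
    (\prod_(i < N) (if a i then 'X_i else 1 - 'X_i)).@[fun i => (x i)%:R]
      = (a == x)%:R :> R.
  rewrite rmorph_prod /=.
  have [->|/eqP neq_ax] := eqVneq a x.
    apply: big1 => i _; case xi: (x i); first by rewrite mevalXU xi.
    by rewrite mevalB meval1 mevalXU xi subr0.
  have [i nai] : exists i, a i != x i.
    apply/existsP; apply: contra_notT neq_ax => /existsPn ax.
    by apply/ffunP => i; apply/eqP; move: (ax i); rewrite negbK.
  rewrite (bigD1 i) //=; case ai: (a i) nai; case xi: (x i) => // _.
    by rewrite mevalXU xi mul0r.
  by rewrite mevalB meval1 mevalXU xi subrr mul0r.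
under eq_bigr => a _ do rewrite E.
case hx: (h x).
  by rewrite (bigD1 x) //= eqxx big1 ?addr0 // => a /andP[_ /negPf ->].
apply: big1 => a ha; case: eqP => // ax; by rewrite ax hx in ha.
Qed.

Lemma has_approx_exists (R : realType) (N : nat) (h : boolean_fun N) :
  exists d : nat, `[< has_approx_of_degree R h d >].
Proof.
exists (msize (interpolant R h)).-1; apply/asboolP.
exists (interpolant R h); split=> // x.
by rewrite interpolantE subrr normr0 divr_ge0.
Qed.

Definition approx_degree (R : realType) (N : nat) (h : boolean_fun N) : nat :=
  ex_minn (has_approx_exists R h).

(* Main.v *)
(* Let d be the approximate degree of f, let p approximate OR_n o f, and let D be
   the degree of p.  Filling the blocks outside S with an input where f vanishes
   turns p into a noisy query "is f(x_i) = 0 for all i in S?", for every set S of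
   blocks.  These queries form a diagonal operator close to the projection P_z
   onto the sets disjoint from z = (f(x_1), .., f(x_n)).  Alternate a rotation of
   n qubits by the angle pi / K with P_z, where K is about sqrt n.  By the quantum
   Zeno effect qubit i completes the rotation by pi (factor -1) if z_i = 0 and is
   frozen (factor cos^K) if z_i = 1.  After K steps the amplitude of the initial
   state is thus the parity of z up to a sign and a factor in [2^-K, 1].

   For the noise, write P_z as a series of polynomials in the noisy query with
   geometrically decreasing norms and expand the product of the K factors.  The
   terms of total order above 6 K contribute little, since rotations preserve the
   euclidean norm.  This leaves a bounded polynomial of degree O(sqrt n D) having
   the sign of parity o f with margin 2^-O(n).

   Such a polynomial has degree Omega(n d).  By LP duality there is psi orthogonal
   to degree a = Omega(d) that disagrees in sign with f on a tiny fraction of its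
   mass.  Multiplying the n-fold tensor power of psi by a polynomial of degree n/2
   in the number of sign errors, with roots 1, .., n/2, keeps it orthogonal to
   degree less than (n/2)(a + 1) and moves all but a fraction 2^-O(n) of its mass
   to points without errors. *)

Require Import Defs.
From mathcomp Require Import all_boot all_order all_algebra.
From mathcomp Require Import reals.
From mathcomp Require boolp.
From mathcomp Require Import mpoly complex ring lra zify.

Set Implicit Arguments.
Unset Strict Implicit.
Unset Printing Implicit Defensive.

Import Order.TTheory GRing.Theory Num.Theory.

Local Open Scope ring_scope.

(** * Functions of bounded degree on the cube *)

Section Degree.
Variables (R : realType) (N : nat).
Implicit Types (g h : cube N -> R) (d e : nat).

(** Degree is a property of functions on the cube, so polynomials with the same values need not be
    told apart. The form [d.+1] also admits the zero polynomial. *)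
Definition deg_le d g :=
  exists2 p : {mpoly R[N]}, (msize p <= d.+1)%N & cube_eval p =1 g.

Lemma deg_le_ext d g h : g =1 h -> deg_le d g -> deg_le d h.
Proof. by move=> gh [p sp pg]; exists p => // x; rewrite pg. Qed.

Lemma deg_leW d e g : (d <= e)%N -> deg_le d g -> deg_le e g.
Proof. by move=> de [p sp pg]; exists p => //; apply: leq_trans sp _. Qed.

Lemma deg_le_const d (c : R) : deg_le d (fun=> c).
Proof.
exists c%:MP => [|x]; last by rewrite /cube_eval mevalC.
by rewrite msizeC; case: (c != 0).
Qed.

Lemma deg_le_coord (k : 'I_N) : deg_le 1 (fun x => (x k)%:R).
Proof.
exists 'X_k => [|x]; last by rewrite /cube_eval mevalXU.
by rewrite msizeX mdeg1.
Qed.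

Lemma deg_leD d g h : deg_le d g -> deg_le d h -> deg_le d (fun x => g x + h x).
Proof.
move=> [p sp pg] [q sq qh]; exists (p + q) => [|x].
  by apply: leq_trans (msizeD_le _ _) _; rewrite geq_max sp.
by rewrite /cube_eval mevalD -pg -qh.
Qed.

Lemma deg_leM d e g h :
  deg_le d g -> deg_le e h -> deg_le (d + e) (fun x => g x * h x).
Proof.
move=> [p sp pg] [q sq qh]; exists (p * q) => [|x].
  have [->|p0] := eqVneq p 0; first by rewrite mul0r msize0.
  have [->|q0] := eqVneq q 0; first by rewrite mulr0 msize0.
  by rewrite msizeM //; move: (msize p) (msize q) sp sq => a b; lia.
by rewrite /cube_eval mevalM -pg -qh.
Qed.

Lemma deg_leZ d (c : R) g : deg_le d g -> deg_le d (fun x => c * g x).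
Proof. exact: (@deg_leM 0%N d (fun=> c) g (deg_le_const 0 c)). Qed.

Lemma deg_leB d g h : deg_le d g -> deg_le d h -> deg_le d (fun x => g x - h x).
Proof.
move=> dg dh; apply: deg_le_ext (deg_leD dg (deg_leZ (-1) dh)) => x.
by rewrite mulN1r.
Qed.

Lemma deg_le_sum (I : Type) (r : seq I) (P : pred I) d (g : I -> cube N -> R) :
  (forall i, P i -> deg_le d (g i)) ->
  deg_le d (fun x => \sum_(i <- r | P i) g i x).
Proof.
move=> dg; elim: r => [|i r IH].
  by apply: deg_le_ext (deg_le_const d 0) => x; rewrite big_nil.
case Pi: (P i).
  apply: deg_le_ext (deg_leD (dg _ Pi) IH) => x.
  by rewrite [RHS]big_cons Pi.
by apply: deg_le_ext IH => x; rewrite [RHS]big_cons Pi.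
Qed.

Lemma deg_le_prod (I : Type) (r : seq I) (d : I -> nat) (g : I -> cube N -> R) :
  (forall i, deg_le (d i) (g i)) ->
  deg_le (\sum_(i <- r) d i) (fun x => \prod_(i <- r) g i x).
Proof.
move=> dg; elim: r => [|i r IH].
  by apply: deg_le_ext (deg_le_const _ 1) => x; rewrite big_nil.
rewrite big_cons; apply: deg_le_ext (deg_leM (dg i) IH) => x.
by rewrite [RHS]big_cons.
Qed.

Lemma deg_leX d g k : deg_le d g -> deg_le (d * k) (fun x => g x ^+ k).
Proof.
move=> dg; elim: k => [|k IH].
  by apply: deg_le_ext (deg_le_const _ 1) => x; rewrite expr0.
rewrite mulnS; apply: deg_le_ext (deg_leM dg IH) => x.
by rewrite exprS.
Qed.

Definition monom (m : 'X_{1..N}) (x : cube N) : R :=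
  \prod_(k < N) (x k)%:R ^+ m k.

Lemma deg_leP d g : deg_le d g ->
  exists p : {mpoly R[N]}, (forall m, m \in msupp p -> (mdeg m <= d)%N) /\
    forall x, g x = \sum_(m <- msupp p) p@_m * monom m x.
Proof.
move=> [p sp pg]; exists p; split=> [m /msize_mdeg_lt mp|x].
  by rewrite -ltnS; apply: leq_trans mp sp.
by rewrite -pg /cube_eval mevalE.
Qed.

Lemma deg_le_monom (m : 'X_{1..N}) : deg_le (mdeg m) (monom m).
Proof.
exists 'X_[m] => [|x]; first by rewrite msizeX.
by rewrite /cube_eval mevalX.
Qed.

End Degree.

Lemma deg_le_comp (R : realType) (M N : nat) (s : cube M -> cube N) d
    (g : cube N -> R) :
  (forall k, deg_le 1 (fun x => (s x k)%:R : R)) ->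
  deg_le d g -> deg_le d (fun x => g (s x)).
Proof.
move=> ds /deg_leP[p [dp pg]].
apply: (@deg_le_ext _ _ _
    (fun x => \sum_(m <- msupp p | m \in msupp p) p@_m * monom R m (s x))).
  by move=> x; rewrite pg -big_seq.
apply: deg_le_sum => m mp; apply: deg_leZ.
apply: (deg_leW (dp _ mp)); rewrite mdegE.
apply: deg_le_prod => k.
by apply: deg_leW (deg_leX (m k) (ds k)); rewrite mul1n.
Qed.

Section ApproxDegree.
Variables (R : realType) (N : nat) (h : boolean_fun N).

Lemma approx_degree_le d (g : cube N -> R) :
  deg_le d g -> (forall x, `|g x - (h x)%:R| <= 1 / 3) ->
  (approx_degree R h <= d)%N.
Proof.
move=> [p sp pg] gh; rewrite /approx_degree; case: ex_minnP => k _ kmin.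
apply: (@leq_trans (msize p).-1); last by rewrite -ltnS; move: sp; case: (msize p).
apply: kmin; apply/boolp.asboolP; exists p; split => // x.
by rewrite distrC pg.
Qed.

Lemma approx_degreeP : exists2 g : cube N -> R,
  deg_le (approx_degree R h) g & forall x, `|g x - (h x)%:R| <= 1 / 3.
Proof.
rewrite /approx_degree; case: ex_minnP => k /boolp.asboolP[p [<- ph]] _.
exists (cube_eval p) => [|x]; last by rewrite distrC.
by exists p => //; case: (msize p).
Qed.

End ApproxDegree.

(** * Error reduction by majority polynomials *)

Lemma bernoulli (R : realDomainType) (x : R) n :
  0 <= x <= 1 -> 1 - n%:R * x <= (1 - x) ^+ n.
Proof.
move=> /andP[x0 x1]; elim: n => [|n IH]; first by rewrite mul0r subr0 expr0.
rewrite exprS; apply: (@le_trans _ _ ((1 - x) * (1 - n%:R * x))).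
  have : 0 <= n%:R * x ^+ 2 by rewrite mulr_ge0 ?exprn_ge0.
  rewrite -natr1; nra.
by rewrite ler_wpM2l // subr_ge0.
Qed.

(** Bernoulli's inequality makes the powers of 1/q grow at least linearly, and the reals are
    Archimedean. *)
Lemma exp_small (R : realType) (q e : R) :
  0 <= q < 1 -> 0 < e -> exists L : nat, q ^+ L <= e.
Proof.
move=> /andP[q0 q1] e0.
have [->|qn0] := eqVneq q 0; first by exists 1%N; rewrite expr1 ltW.
have q_gt0 : 0 < q by rewrite lt_def qn0.
have y0 : 0 < q^-1 - 1 by rewrite subr_gt0 invf_gt1.
have growth n : 1 + n%:R * (q^-1 - 1) <= q^-1 ^+ n.
  elim: n => [|n IH]; first by rewrite mul0r addr0 expr0.
  rewrite exprS; apply: (@le_trans _ _ (q^-1 * (1 + n%:R * (q^-1 - 1)))).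
    have : 0 <= n%:R * (q^-1 - 1) ^+ 2 by rewrite mulr_ge0 ?exprn_ge0 // ltW.
    rewrite -natr1; move: (q^-1) => r; nra.
  by rewrite ler_wpM2l // invr_ge0.
pose L := Num.bound (e^-1 / (q^-1 - 1)); exists L.
rewrite -[leLHS]invrK -[leRHS]invrK lef_pV2 ?posrE ?invr_gt0 ?exprn_gt0 //.
rewrite -exprVn; apply: le_trans (growth L).
have /ltW : e^-1 / (q^-1 - 1) < L%:R.
  apply: archi_boundP; apply: divr_ge0; last exact: ltW.
  by rewrite invr_ge0 ltW.
rewrite ler_pdivrMr // => le; apply: (le_trans le); by rewrite lerDr.
Qed.

Section Amplification.
Variable R : realType.

(** The probability that most of 2m+1 independent coins of bias y show heads, as a polynomial in
    y. *)
Definition majority (m : nat) (y : R) : R :=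
  \sum_(i < m.*2.+2 | (m < i)%N)
    'C(m.*2.+1, i)%:R * (y ^+ i * (1 - y) ^+ (m.*2.+1 - i)).

Lemma binomial_term_le (m i j : nat) (a b : R) :
  0 <= a -> a <= b -> b <= 1 -> (j <= m)%N -> (i + j = m.*2.+1)%N ->
  a ^+ i * b ^+ j <= (a * b) ^+ m.
Proof.
move=> a0 ab b1 jm ij.
have b0 := le_trans a0 ab; have a1 := le_trans ab b1.
rewrite exprMn.
have -> : i = (m + (m - j).+1)%N by lia.
rewrite exprD -mulrA ler_wpM2l ?exprn_ge0 //.
have {2}-> : m = ((m - j) + j)%N by lia.
rewrite exprD ler_wpM2r ?exprn_ge0 //.
rewrite exprS -[leRHS]mul1r ler_pM ?exprn_ge0 //.
by apply: lerXn2r; rewrite ?nnegrE.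
Qed.

Lemma sum_binomial_le (n : nat) (P : pred 'I_n.+1) (F : 'I_n.+1 -> R) c :
  (forall i, P i -> F i <= c) -> 0 <= c ->
  \sum_(i < n.+1 | P i) 'C(n, i)%:R * F i <= 2 ^+ n * c.
Proof.
move=> Fc c0.
apply: (@le_trans _ _ (\sum_(i < n.+1) 'C(n, i)%:R * c)).
  rewrite big_mkcond /=; apply: ler_sum => i _; case: ifP => Pi.
    by rewrite ler_wpM2l ?Fc.
  by rewrite mulr_ge0.
rewrite -mulr_suml.
have -> : \sum_(i < n.+1) 'C(n, i)%:R = 2 ^+ n :> R.
  rewrite -[2]/(1 + 1) exprDn; apply: eq_bigr => i _.
  by rewrite !expr1n mulr1.
by [].
Qed.

(** Each term is at most (y(1-y))^m up to its binomial coefficient, and these coefficients add up to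
    at most 2^(2m+1) = 2 * 4^m. *)
Lemma majority_small m y : 0 <= y <= 1 / 2 ->
  0 <= majority m y <= 2 * (4 * (y * (1 - y))) ^+ m.
Proof.
move=> /andP[y0 y1].
have z0 : 0 <= 1 - y by lra.
apply/andP; split.
  by apply: sumr_ge0 => i _; rewrite !mulr_ge0 ?exprn_ge0.
have -> : 2 * (4 * (y * (1 - y))) ^+ m = 2 ^+ m.*2.+1 * (y * (1 - y)) ^+ m.
  rewrite exprMn mulrA; congr (_ * _).
  by rewrite exprS -mul2n exprM; congr (_ * _ ^+ _); ring.
apply: sum_binomial_le; last by rewrite exprn_ge0 ?mulr_ge0.
move=> i mi; have iM := ltn_ord i; apply: binomial_term_le => //; [lra | lra | lia | lia].
Qed.

(** Exchange heads and tails; the number of coins is odd, so there are no ties. *)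
Lemma majorityC m y : majority m y = 1 - majority m (1 - y).
Proof.
suff E : majority m y + majority m (1 - y) = 1 by lra.
have E : (y + (1 - y)) ^+ m.*2.+1 = 1 by rewrite addrC subrK expr1n.
rewrite -[RHS]E exprDn addrC (bigID (fun i : 'I_m.*2.+2 => (m < i)%N)) /=.
congr (_ + _); last first.
  rewrite /majority (reindex_inj rev_ord_inj) /=.
  apply: eq_big => [i|i _]; first by rewrite subSS; move: (ltn_ord i); lia.
  have iM : (i <= m.*2.+1)%N by rewrite -ltnS.
  by rewrite subSS bin_sub // mulr_natl subKn.
apply: eq_bigr => i _; rewrite mulr_natl mulrC; congr (_ ^+ _ * _ *+ _); ring.
Qed.

(** An affine map sends the values of g to a bias at distance at least [delta / 2] from 1/2, on the
    side given by h; the majority of many coins then errs exponentially rarely. *)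
Lemma amplify (delta : R) : 0 < delta ->
  exists L : nat, forall (N D : nat) (h : boolean_fun N) (g : cube N -> R) (k : nat),
    deg_le D g -> (forall x, `|g x - (h x)%:R| <= 1 / 2 - delta) ->
    exists2 g' : cube N -> R, deg_le (L * k.+1 * D) g' &
      forall x, `|g' x - (h x)%:R| <= 4 ^- k.
Proof.
move=> d0; have [d1|d1] := leP delta (1 / 2); last first.
  exists 0%N => N D h g k _ /(_ [ffun=> false]) gh.
  have := normr_ge0 (g [ffun=> false] - (h [ffun=> false])%:R); lra.
(* At a bias z at most 1/2 - delta/2, 4z(1-z) = 1 - (1-2z)^2 is at most 1 - delta^2. Reaching 1/8
   gives the error 2 * 8^-(k+1) <= 4^-k. *)
have [||L qL] := @exp_small R (1 - delta ^+ 2) (1 / 8);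
  [by apply/andP; split; nra | lra |].
exists (L.*2.+1) => N D h g k dg gh.
pose m := (L * k.+1)%N.
pose y x := 1 / 4 + 1 / 2 * g x.
exists (fun x => majority m (y x)) => [|x].
  have dy : deg_le D y.
    by apply: deg_leD; [apply: deg_le_const | apply: deg_leZ].
  have dy' : deg_le D (fun x => 1 - y x).
    by apply: deg_leB => //; apply: deg_le_const.
  apply: deg_le_sum => i _; apply: deg_leZ.
  apply: deg_leW (deg_leM (deg_leX _ dy) (deg_leX _ dy')).
  rewrite -mulnDr subnKC -1?ltnS // /m mulnC; apply: leq_mul => //; nia.
have small z : delta / 2 <= z <= 1 / 2 - delta / 2 -> `|majority m z| <= 4 ^- k.
  move=> /andP[z0 z1].
  have /andP[M0 M1] := @majority_small m z ltac:(apply/andP; split; lra).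
  rewrite ger0_norm //; apply: le_trans M1 _.
  have zq : 0 <= 4 * (z * (1 - z)) <= 1 - delta ^+ 2 by apply/andP; split; nra.
  apply: (@le_trans _ _ (2 * (1 / 8) ^+ k.+1)).
    rewrite ler_pM2l // /m exprM; case/andP: zq => zq0 zq1.
    apply: lerXn2r; rewrite ?nnegrE ?exprn_ge0 //; first lra.
    by apply: le_trans qL; apply: lerXn2r; rewrite ?nnegrE // (le_trans zq0).
  rewrite exprS -exprVn.
  have : (1 / 8) ^+ k <= 4^-1 ^+ k :> R.
    by apply: lerXn2r; rewrite ?nnegrE; lra.
  have : 0 <= (1 / 8) ^+ k :> R by apply: exprn_ge0; lra.
  move: (_ ^+ k) (_ ^+ k) => a b; lra.
move: (gh x); rewrite ler_norml => /andP[g1 g2].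
case hx : (h x) g1 g2 => /= g1 g2; last first.
  by rewrite subr0; apply: small; rewrite /y; apply/andP; split; lra.
rewrite majorityC addrAC subrr add0r normrN.
by apply: small; rewrite /y; apply/andP; split; lra.
Qed.

End Amplification.

(** * Linear programming duality *)

Section Duality.
Variable R : realFieldType.

(** Supplies the value of the variable eliminated in [farkas]. *)
Lemma between_families (J : finType) (P Q : pred J) (l u : J -> R) :
  (forall q p, Q q -> P p -> l q <= u p) ->
  exists t, (forall q, Q q -> l q <= t) /\ (forall p, P p -> t <= u p).
Proof.
move=> lu; have [q0 Qq0|Q0] := pickP Q.
  case: (@Order.TotalTheory.arg_maxP _ _ _ q0 Q l Qq0) => q Qq qmax.
  by exists (l q); split=> [q' /qmax|p Pp] //; apply: lu.
have [p0 Pp0|P0] := pickP P.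
  case: (@Order.TotalTheory.arg_minP _ _ _ p0 P u Pp0) => p Pp pmin.
  by exists (u p); split=> [q'|p' /pmin] //; rewrite Q0.
by exists 0; split=> j; rewrite ?Q0 ?P0.
Qed.

Lemma sum_delta (J : finType) (j : J) (x : R) (F : J -> R) :
  \sum_i ((i == j)%:R * x) * F i = x * F j.
Proof.
rewrite (bigD1 j) //= eqxx mul1r big1 ?addr0 // => i /negPf ->.
by rewrite !mul0r.
Qed.

(** Induction on the number of variables. A solution of the reduced system extends by a suitable
    last variable; a certificate of its infeasibility pulls back to the original constraints. *)
Lemma farkas (k : nat) (J : finType) (a : J -> nat -> R) (b : J -> R) :
  (exists c : nat -> R, forall j, \sum_(i < k) a j i * c i <= b j) \/
  (exists w : J -> R, [/\ forall j, 0 <= w j,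
     forall i : 'I_k, \sum_j w j * a j i = 0 & \sum_j w j * b j < 0]).
Proof.
elim: k J a b => [|k IH] J a b.
  have [/forallP b0|/forallPn[j]] := boolP [forall j, 0 <= b j].
    by left; exists (fun=> 0) => j; rewrite big_ord0.
  rewrite -ltNge => bj; right; exists (fun i => (i == j)%:R * 1); split.
  - by move=> i; rewrite mulr1.
  - by case.
  - by rewrite sum_delta mul1r.
(* Fourier-Motzkin: the combinations M s of the constraints eliminate variable k. *)
pose M (s : J + J * J) (i : J) : R :=
  match s with
  | inl j => if a j k == 0 then (i == j)%:R * 1 else 0
  | inr (p, q) => if (0 < a p k) && (a q k < 0) then
      (i == p)%:R * - a q k + (i == q)%:R * a p k else 0
  end.
have MF s F : \sum_i M s i * F i = match s with
  | inl j => if a j k == 0 then F j else 0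
  | inr (p, q) => if (0 < a p k) && (a q k < 0) then
      - a q k * F p + a p k * F q else 0 end.
  case: s => [j|[p q]] /=; case: ifP => _; try by rewrite big1 // => i _; rewrite mul0r.
    by rewrite sum_delta mul1r.
  under eq_bigr do rewrite mulrDl.
  by rewrite big_split /= !sum_delta.
have M0 s i : 0 <= M s i.
  case: s => [j|[p q]] /=; first by case: ifP => //; rewrite mulr1.
  case: ifP => // /andP[p0 q0].
  by apply: addr_ge0; apply: mulr_ge0; rewrite ?oppr_ge0 ?ler0n // ltW.
have [[c cP]|[w [w0 wa wb]]] := IH (J + J * J)%type
    (fun s i => \sum_j M s j * a j i) (fun s => \sum_j M s j * b j).
  left.
  pose S j := \sum_(i < k) a j i * c i.
  have cS s : \sum_j M s j * S j <= \sum_j M s j * b j.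
    apply: le_trans (cP s); rewrite le_eqVlt; apply/orP; left; apply/eqP.
    under [RHS]eq_bigr do rewrite mulr_suml.
    rewrite exchange_big /=; apply: eq_bigr => j _.
    by rewrite mulr_sumr; apply: eq_bigr => i _; rewrite mulrA.
  have [|t [tl tu]] := @between_families J (fun p => 0 < a p k) (fun q => a q k < 0)
     (fun j => (b j - S j) / a j k) (fun j => (b j - S j) / a j k).
    move=> q p q0 p0; move: (cS (inr (p, q))); rewrite !MF p0 q0 /=.
    by rewrite ler_pdivlMr // mulrAC ler_ndivrMr // => H; nra.
  exists (fun i => if i == k then t else c i) => j.
  rewrite big_ord_recr /= eqxx.
  rewrite (eq_bigr (fun i : 'I_k => a j i * c i)) => [|i _]; last first.
    by rewrite (ltn_eqF (ltn_ord i)).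
  rewrite -/(S j); case: (ltrgtP (a j k) 0) => aj.
  - by move: (tl _ aj); rewrite ler_ndivrMr //; nra.
  - by move: (tu _ aj); rewrite ler_pdivlMr //; nra.
  - by move: (cS (inl j)); rewrite !MF aj eqxx mul0r addr0.
right.
have swap F : \sum_j (\sum_s w s * M s j) * F j = \sum_s w s * \sum_j M s j * F j.
  under eq_bigr do rewrite mulr_suml.
  rewrite exchange_big /=; apply: eq_bigr => s _.
  by rewrite mulr_sumr; apply: eq_bigr => j _; rewrite mulrA.
exists (fun j => \sum_s w s * M s j); split.
- by move=> j; apply: sumr_ge0 => s _; rewrite mulr_ge0.
- move=> i; rewrite swap; have [->|ik] := eqVneq (i : nat) k.
    apply: big1 => s _; rewrite MF; case: s => [j|[p q]].
      by case: eqP => [->|_]; rewrite ?mulr0.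
    by case: ifP => _; rewrite ?mulr0 // mulrC; ring.
  have ltik : (i < k)%N by move: (ltn_ord i); rewrite ltnS leq_eqVlt (negPf ik).
  exact: (wa (Ordinal ltik)).
- by rewrite swap.
Qed.

(** Farkas' lemma for two one-sided constraints at each point, the boolean giving the side. The dual
    function is the difference of the two weights, and their sum bounds its absolute value. *)
Lemma sup_duality (T I : finType) (b : I -> T -> R) (f : T -> R) (e : R) :
  0 <= e ->
  (exists c : I -> R, forall x, `|\sum_i c i * b i x - f x| <= e) \/
  (exists psi : T -> R, (forall i, \sum_x psi x * b i x = 0) /\
     e * \sum_x `|psi x| < \sum_x psi x * f x).
Proof.
move=> e0; pose sg (s : bool) : R := if s then 1 else -1.
pose a (j : T * bool) (i : nat) : R :=
  if insub i is Some i' then sg j.2 * b (enum_val (i' : 'I_#|I|)) j.1 else 0.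
have aE j (i : 'I_#|I|) : a j i = sg j.2 * b (enum_val i) j.1 by rewrite /a valK.
have [[c cP]|[w [w0 wa wb]]] := @farkas #|I| _ a (fun j => e + sg j.2 * f j.1).
  left; exists (fun i => c (enum_rank i)) => x.
  have E s : \sum_(i < #|I|) a (x, s) i * c i
      = sg s * \sum_i c (enum_rank i) * b i x.
    rewrite (big_enum_val (A := I)) /= mulr_sumr; apply: eq_bigr => i _.
    by rewrite aE enum_valK /=; ring.
  move: (cP (x, true)) (cP (x, false)); rewrite !E /= => H1 H2.
  rewrite ler_norml; apply/andP; split; lra.
right; exists (fun x => w (x, false) - w (x, true)).
have split2 (F : T * bool -> R) : \sum_j F j = \sum_x (F (x, false) + F (x, true)).
  rewrite (eq_bigr (fun p => F (p.1, p.2))) => [|[]] //.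
  rewrite -(pair_bigA _ (fun x s => F (x, s))) /=.
  by apply: eq_bigr => x _; rewrite big_bool addrC.
split=> [i|].
  have := wa (enum_rank i); rewrite split2.
  move=> /(congr1 -%R); rewrite oppr0 -sumrN => E; rewrite -[RHS]E.
  apply: eq_bigr => x _.
  by rewrite !aE enum_rankK /=; ring.
rewrite -subr_gt0; apply: (@lt_le_trans _ _ (- \sum_j w j * (e + sg j.2 * f j.1))).
  by rewrite oppr_gt0.
rewrite split2 /= mulr_sumr -sumrN -sumrB; apply: ler_sum => x _.
have nw : `|w (x, false) - w (x, true)| <= w (x, false) + w (x, true).
  by rewrite ler_norml; have := w0 (x, false); have := w0 (x, true); lra.
have := ler_wpM2l e0 nw; move: `|_| => z; lra.
Qed.

End Duality.

(** * Truncated products of noisy projections *)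

Section Zeno.
Variables (R : realFieldType) (A : finType) (M : A -> A -> R).
Hypothesis M_orth : forall a a', \sum_b M a b * M a' b = (a == a')%:R.

(* The euclidean norm of v is at most C; the dual form makes the triangle
   inequality trivial. *)
Definition norm_le (v : A -> R) (C : R) : Prop :=
  forall u : A -> R, \sum_a u a ^+ 2 <= 1 -> `|\sum_a u a * v a| <= C.

Definition kernel_app (v : A -> R) (a : A) : R := \sum_b M a b * v b.

Lemma norm_le_ext v w C : v =1 w -> norm_le v C -> norm_le w C.
Proof.
move=> vw nv u /nv; congr (`| _ | <= _); apply: eq_bigr => a _; by rewrite vw.
Qed.

Lemma norm_leW v C C' : C <= C' -> norm_le v C -> norm_le v C'.
Proof. by move=> CC nv u /nv h; apply: le_trans h CC. Qed.

Lemma norm_leD v w C C' :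
  norm_le v C -> norm_le w C' -> norm_le (fun a => v a + w a) (C + C').
Proof.
move=> nv nw u hu; under eq_bigr do rewrite mulrDr.
by rewrite big_split /=; apply: le_trans (ler_normD _ _) _; rewrite lerD ?nv ?nw.
Qed.

Lemma norm_le_sum (n : nat) (v : 'I_n -> A -> R) (C : 'I_n -> R) :
  (forall i, norm_le (v i) (C i)) ->
  norm_le (fun a => \sum_(i < n) v i a) (\sum_(i < n) C i).
Proof.
move=> nv u hu; under eq_bigr do rewrite mulr_sumr.
rewrite exchange_big /=; apply: le_trans (ler_norm_sum _ _ _) _.
by apply: ler_sum => i _; apply: nv.
Qed.

(** The ratio D / k is absorbed into the test vector u without increasing its norm. *)
Lemma norm_le_diag (D v : A -> R) (k C : R) : 0 <= k ->
  (forall a, `|D a| <= k) -> norm_le v C -> norm_le (fun a => D a * v a) (k * C).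
Proof.
move=> k0 Dk nv u hu; have [k00|kn0] := eqVneq k 0.
  rewrite big1 => [|a _]; first by rewrite normr0 k00 mul0r.
  by move: (Dk a); rewrite k00 normr_le0 => /eqP ->; rewrite mul0r mulr0.
have kp : 0 < k by rewrite lt_def kn0.
have -> : \sum_a u a * (D a * v a) = k * \sum_a (u a * (D a / k)) * v a.
  by rewrite mulr_sumr; apply: eq_bigr => a _; field.
rewrite normrM ger0_norm // ler_pM2l //; apply: nv.
apply: le_trans hu; apply: ler_sum => a _.
rewrite exprMn -[leRHS]mulr1 ler_wpM2l ?sqr_ge0 //.
rewrite -real_normK ?num_real // exprn_ile1 //.
by rewrite normrM normfV [`|k|]ger0_norm // ler_pdivrMr ?mul1r.
Qed.

(** The transpose of M acts on the test vector and preserves its norm because the rows of M are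
    orthonormal. *)
Lemma norm_le_app v C : norm_le v C -> norm_le (kernel_app v) C.
Proof.
move=> nv u hu.
have -> : \sum_a u a * kernel_app v a = \sum_b (\sum_a u a * M a b) * v b.
  rewrite /kernel_app; under eq_bigr do rewrite mulr_sumr.
  rewrite exchange_big /=; apply: eq_bigr => b _.
  by rewrite mulr_suml; apply: eq_bigr => a _; rewrite mulrA.
apply: nv; apply: le_trans hu; rewrite le_eqVlt; apply/orP; left; apply/eqP.
under eq_bigr => b _.
  rewrite expr2 mulr_suml; under eq_bigr do rewrite mulr_sumr.
  over.
rewrite exchange_big /=; apply: eq_bigr => a _.
rewrite exchange_big /= (bigD1 a) //= [X in _ + X]big1 => [|a' a'a].
  rewrite addr0; transitivity (u a ^+ 2 * \sum_b M a b * M a b).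
    by rewrite mulr_sumr; apply: eq_bigr => b _; ring.
  by rewrite M_orth eqxx mulr1.
transitivity (u a * u a' * \sum_b M a b * M a' b).
  by rewrite mulr_sumr; apply: eq_bigr => b _; ring.
by rewrite M_orth eq_sym (negPf a'a) mulr0.
Qed.

Fixpoint zeno (P v0 : A -> R) (t : nat) (a : A) : R :=
  if t is t'.+1 then P a * kernel_app (zeno P v0 t') a else v0 a.

Definition increment (Y : nat -> A -> R) (k : nat) (a : A) : R :=
  if k is k'.+1 then Y k a - Y k' a else Y 0%N a.

(* Expand each factor P of zeno as the telescoping series of the increments of
   its approximations Y, and keep the terms of total order at most J. *)
Fixpoint zeno_trunc (Y : nat -> A -> R) (v0 : A -> R) (t J : nat) (a : A) : R :=
  if t is t'.+1 then
    \sum_(k < J.+1) increment Y k a * kernel_app (zeno_trunc Y v0 t' (J - k)) a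
  else v0 a.

Lemma sum_increment Y J a : \sum_(k < J.+1) increment Y k a = Y J a.
Proof.
elim: J => [|J IH]; first by rewrite big_ord1.
by rewrite big_ord_recr IH /= addrC subrK.
Qed.

Lemma geometric_half n : \sum_(k < n) (2%:R : R) ^- k = 2 - 2 * 2 ^- n.
Proof.
elim: n => [|n IH]; first by rewrite big_ord0 expr0 invr1; ring.
rewrite big_ord_recr /= IH exprS invfM.
have : (2 : R)^-1 = 1 / 2 by rewrite mul1r.
by move=> ->; move: (_ ^- n) => x; field.
Qed.

Lemma norm_le_zeno P v0 t : (forall a, `|P a| <= 1) -> norm_le v0 1 ->
  norm_le (zeno P v0 t) 1.
Proof.
move=> P1 v01; elim: t => [//|t IH] /=.
rewrite -[1]mulr1; apply: norm_le_diag => //; exact: norm_le_app.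
Qed.

(** Induction on t. A round costs 4^-J for the tail of the series, plus the sum over k of 5 * 4^-k
    times the earlier error at order J - k. As that error is bounded by a multiple of 2^-(J-k), the
    sum is at most 10 times the earlier bound, and 15 leaves room for the tail. *)
Lemma zeno_trunc_error P Y v0 t J :
  (forall a, `|P a| <= 1) -> norm_le v0 1 ->
  (forall k a, `|Y k a - P a| <= 4 ^- k) ->
  norm_le (fun a => zeno P v0 t a - zeno_trunc Y v0 t J a)
    ((15 ^+ t - 1) * 2 ^- J).
Proof.
move=> P1 v01 YP.
(* Consecutive approximations differ by at most 4^-k + 4^-(k-1) = 5 * 4^-k; for k = 0 even 2
   suffices. *)
have inc k a : `|increment Y k a| <= 5 * 4 ^- k.
  case: k => [|k] /=.
    move: (YP 0%N a) (P1 a); rewrite expr0 invr1 !ler_norml.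
    by move=> /andP[? ?] /andP[? ?]; apply/andP; split; lra.
  move: (YP k a) (YP k.+1 a); rewrite exprS invfM !ler_norml.
  move: (4 ^- k) => x /andP[? ?] /andP[? ?]; apply/andP; split; lra.
elim: t J => [|t IH] J.
  rewrite expr0 subrr mul0r => u _ /=.
  by rewrite big1 ?normr0 // => a _; rewrite subrr mulr0.
(* The tail of the series acts on the exact state, the kept increments on the errors of the
   truncated states. *)
apply: (@norm_le_ext (fun a => (P a - Y J a) * kernel_app (zeno P v0 t) a +
  \sum_(k < J.+1) increment Y k a *
     kernel_app (fun b => zeno P v0 t b - zeno_trunc Y v0 t (J - k) b) a)).
  move=> a /=; rewrite -(sum_increment Y J a) mulrBl -addrA; congr (_ + _).
  rewrite mulr_suml -sumrN -big_split /= -sumrN; apply: eq_bigr => k _.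
  have -> : kernel_app (fun b => zeno P v0 t b - zeno_trunc Y v0 t (J - k) b) a
    = kernel_app (zeno P v0 t) a - kernel_app (zeno_trunc Y v0 t (J - k)) a.
    by rewrite /kernel_app -sumrB; apply: eq_bigr => b _; rewrite mulrBr.
  by ring.
apply: (@norm_leW _ (4 ^- J * 1 +
    \sum_(k < J.+1) (5 * 4 ^- k) * ((15 ^+ t - 1) * 2 ^- (J - k)))).
  have e15 : 1 <= 15 ^+ t :> R by apply: exprn_ege1; lra.
  have -> : \sum_(k < J.+1) (5 * 4 ^- k) * ((15 ^+ t - 1) * 2 ^- (J - k)) =
     (5 * (15 ^+ t - 1) * 2 ^- J) * \sum_(k < J.+1) 2 ^- k :> R.
    rewrite mulr_sumr; apply: eq_bigr => k _.
    have kJ : (k <= J)%N by rewrite -ltnS.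
    have -> : (2 : R) ^- J = 2 ^- (J - k) * 2 ^- k.
      by rewrite -invfM -exprD subnK.
    have -> : (4 : R) ^- k = 2 ^- k * 2 ^- k.
      by rewrite -invfM -exprMn; congr (_ ^- _); ring.
    by ring.
  rewrite geometric_half [15 ^+ t.+1]exprS.
  have p2 : 0 <= 2 ^- J :> R by rewrite invr_ge0 exprn_ge0.
  have p2' : 0 <= 2 ^- J.+1 :> R by rewrite invr_ge0 exprn_ge0.
  have p4 : 4 ^- J <= 2 ^- J :> R.
    by rewrite lef_pV2 ?posrE ?exprn_gt0 //; apply: lerXn2r; rewrite ?nnegrE; lra.
  have : 0 <= (15 ^+ t - 1) * 2 ^- J * 2 ^- J.+1 :> R.
    by rewrite !mulr_ge0 // subr_ge0.
  have : 0 <= (15 ^+ t - 1) * 2 ^- J :> R by rewrite !mulr_ge0 // subr_ge0.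
  move: (15 ^+ t) (2 ^- J) (2 ^- J.+1) (4 ^- J) e15 p2 p2' p4.
  by move=> x y z w ? ? ? ? ? ?; lra.
apply: norm_leD.
  apply: norm_le_diag; first by rewrite invr_ge0 exprn_ge0.
    by move=> a; rewrite distrC.
  by apply: norm_le_app; apply: norm_le_zeno.
apply: norm_le_sum => k; apply: norm_le_diag => //.
  by rewrite mulr_ge0 // invr_ge0 exprn_ge0.
exact: norm_le_app.
Qed.

End Zeno.

(** * Rotations of n qubits *)

Section Rotation.
Variables (R : realType) (n : nat) (c s : R).
Hypothesis cs1 : c ^+ 2 + s ^+ 2 = 1.
Implicit Types a b z : cube n.

(** The matrix of a plane rotation with cosine c and sine s; [rotM] is its n-fold tensor power. *)
Definition rot2 (i j : bool) : R := if i == j then c else if i then s else - s.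

Definition rotM a b : R := \prod_(i < n) rot2 (a i) (b i).

Lemma sum_cube_prod (F : 'I_n -> bool -> R) :
  \sum_(b : cube n) \prod_i F i (b i) = \prod_i (F i false + F i true).
Proof.
rewrite -(bigA_distr_bigA F) /=; apply: eq_bigr => i _.
by rewrite big_bool addrC.
Qed.

Lemma rotM_orth a a' : \sum_b rotM a b * rotM a' b = (a == a')%:R.
Proof.
under eq_bigr do rewrite -big_split /=.
rewrite (sum_cube_prod (fun i j => rot2 (a i) j * rot2 (a' i) j)).
have [->|/eqP aa'] := eqVneq a a'.
  apply: big1 => i _; rewrite /rot2.
  by case: (a' i) => /=; rewrite -?expr2 ?sqrrN -cs1 // addrC.
have [i ai] : exists i, a i != a' i.
  apply/existsP; apply: contra_notT aa' => /existsPn aa'.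
  by apply/ffunP => i; apply/eqP; rewrite -[_ == _]negbK aa'.
rewrite (bigD1 i) //= /rot2; case: (a i) (a' i) ai => [] [] //= _.
  by rewrite mulrN [c * s]mulrC subrr mul0r.
by rewrite mulNr [s * c]mulrC subrr mul0r.
Qed.

Lemma app_rotM_prod (w : 'I_n -> bool -> R) a :
  kernel_app rotM (fun b => \prod_i w i (b i)) a
  = \prod_i (rot2 (a i) false * w i false + rot2 (a i) true * w i true).
Proof.
rewrite -(sum_cube_prod (fun i j => rot2 (a i) j * w i j)).
by apply: eq_bigr => b _; rewrite big_split.
Qed.

(** The diagonal of P_z. Its product form, like that of [zeros_ind], keeps the evolving state a
    product over qubits. *)
Definition disjoint_ind z a : R := \prod_(i < n) (~~ (a i && z i))%:R.

Definition zeros_ind a : R := \prod_(i < n) (~~ a i)%:R.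

Let zeta : R[i] := Complex c s.

(** A free qubit ([zi] false) has turned t times, so its amplitudes are the parts of zeta^t; a
    watched one loses its component at 1 in every round and retains c^t. *)
Definition qubit (t : nat) (zi ai : bool) : R :=
  if zi then (if ai then 0 else c ^+ t)
  else (if ai then complex.Im (zeta ^+ t) else complex.Re (zeta ^+ t)).

Lemma zeno_prod z t a :
  zeno rotM (disjoint_ind z) zeros_ind t a = \prod_i qubit t (z i) (a i).
Proof.
elim: t a => [|t IH] a /=.
  apply: eq_bigr => i _; rewrite /qubit !expr0.
  by case: (z i); case: (a i).
have -> : kernel_app rotM (zeno rotM (disjoint_ind z) zeros_ind t) a
   = \prod_i (rot2 (a i) false * qubit t (z i) false +
               rot2 (a i) true * qubit t (z i) true).
  rewrite -(app_rotM_prod (fun i => qubit t (z i))).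
  by apply: eq_bigr => b _; rewrite IH.
rewrite -big_split /=; apply: eq_bigr => i _.
rewrite /qubit /rot2 ![_ ^+ t.+1]exprS.
case: (z i); case: (a i) => /=; rewrite ?mul0r ?mul1r ?mulr0 ?addr0 //;
  case: (zeta ^+ t) => x y /=; ring.
Qed.

Lemma zeno_zeros z t : complex.Re (zeta ^+ t) = -1 ->
  zeno rotM (disjoint_ind z) zeros_ind t [ffun=> false]
  = \prod_i (if z i then c ^+ t else -1).
Proof.
move=> zt; rewrite zeno_prod; apply: eq_bigr => i _.
by rewrite ffunE /qubit zt.
Qed.

Lemma norm_le_zeros : norm_le zeros_ind 1.
Proof.
have z0 : zeros_ind [ffun=> false] = 1.
  by apply: big1 => i _; rewrite ffunE.
have zN a : a != [ffun=> false] -> zeros_ind a = 0.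
  move=> a0; have [i ai] : exists i, a i.
    apply/existsP; apply: contraNT a0 => /existsPn a0.
    by apply/eqP/ffunP => i; rewrite ffunE; apply/negbTE.
  by rewrite /zeros_ind (bigD1 i) //= ai mul0r.
move=> u hu; rewrite (bigD1 [ffun=> false]) //= big1 => [|a a0]; last first.
  by rewrite zN ?mulr0.
rewrite z0 mulr1 addr0 -(@ler_pXn2r _ 2) ?nnegrE // expr1n real_normK ?num_real //.
apply: le_trans hu; rewrite (bigD1 [ffun=> false]) //= lerDl.
by apply: sumr_ge0 => a _; apply: sqr_ge0.
Qed.

Lemma disjoint_ind_le1 z a : `|disjoint_ind z a| <= 1.
Proof.
rewrite /disjoint_ind normr_prod.
apply: prodr_ile1 => i _; rewrite normr_ge0 /=; by case: (~~ _); rewrite ?normr1 ?normr0.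
Qed.

End Rotation.

(* Halving the angle repeatedly: (c, s) is the unit vector of angle pi / 2 ^ l.+2. *)
Lemma small_angle (R : realType) (l : nat) : exists c s : R,
  [/\ c ^+ 2 + s ^+ 2 = 1, 0 < c, 0 <= s, s <= 2 ^- l * c &
      (Complex c s : R[i]) ^+ (2 ^ l.+2) = -1].
Proof.
elim: l => [|l [c [s [cs1 c0 s0 sc zl]]]].
  (* Start from the angle pi / 4. *)
  pose c : R := Num.sqrt (1 / 2); exists c, c.
  have c2 : c ^+ 2 = 1 / 2 by rewrite sqr_sqrtr //; lra.
  have c0 : 0 < c by rewrite sqrtr_gt0; lra.
  split=> //; [by rewrite c2; field | exact: ltW | by rewrite expr0 invr1 mul1r |].
  rewrite (exprM _ 2 2); have -> : (Complex c c : R[i]) ^+ 2 = Complex 0 1.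
    by rewrite expr2; congr Complex; rewrite -?expr2 ?c2 ?subrr //; field.
  by rewrite expr2; apply/eqP; rewrite eq_complex /= ; apply/andP; split; apply/eqP; ring.
have c1 : c <= 1 by nra.
(* Half-angle formulas for cosine and sine. *)
pose c' : R := Num.sqrt ((1 + c) / 2); pose s' := s / (2 * c').
have c2 : c' ^+ 2 = (1 + c) / 2 by rewrite sqr_sqrtr //; lra.
have c'0 : 0 < c' by rewrite sqrtr_gt0; lra.
have cs' : 2 * c' * s' = s by rewrite /s'; field; rewrite gt_eqF.
have s2 : s' ^+ 2 = (1 - c) / 2.
  have : (2 * c' * s') ^+ 2 = 4 * c' ^+ 2 * s' ^+ 2 by ring.
  rewrite cs' c2 => E; apply: (@mulfI _ (1 + c)); first by rewrite gt_eqF //; lra.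
  have s2 : s ^+ 2 = (1 - c) * (1 + c) by lra.
  lra.
exists c', s'; split => //.
- by rewrite c2 s2; field.
- by rewrite /s' divr_ge0 // mulr_ge0 // ltW.
(* The tangent bound halves, because s' / c' = s / (1 + c) and c <= (1 + c) / 2. *)
- rewrite /s' ler_pdivrMr ?mulr_gt0 // exprS invfM.
  have -> : 2^-1 * 2 ^- l * c' * (2 * c') = 2 ^- l * c' ^+ 2.
    by move: (2 ^- l) => x; field.
  apply: (le_trans sc); rewrite c2 ler_pM2l ?invr_gt0 ?exprn_gt0 //; lra.
- rewrite expnS exprM -[RHS]zl; congr (_ ^+ _).
  rewrite expr2; congr Complex; first by rewrite -!expr2 c2 s2; field.
  by rewrite -cs'; ring.
Qed.

(** K is the least power of two, at least 4, with K^2 >= 32 n; hence K^2 <= 128 n. With 2^l = K / 4,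
    1 - c <= s^2 <= 4^-l <= 1 / (2n), and Bernoulli's inequality gives c^n >= 1/2. *)
Lemma zeno_angle (R : realType) (n : nat) : (0 < n)%N ->
  exists (K : nat) (c s : R),
  [/\ (K ^ 2 <= 128 * n)%N, c ^+ 2 + s ^+ 2 = 1, 0 <= c <= 1, 1 / 2 <= c ^+ n &
      complex.Re ((Complex c s : R[i]) ^+ K) = -1].
Proof.
move=> n0.
have : exists l, (32 * n <= 4 ^ l.+2)%N.
  exists (32 * n)%N; apply: ltnW.
  by apply: (@leq_trans (4 ^ (32 * n))%N); [apply: ltn_expl | rewrite leq_exp2l //; lia].
case/ex_minnP => l hl lmin.
have ub : (4 ^ l.+2 <= 128 * n)%N.
  case: l hl lmin => [|l] hl lmin; first lia.
  rewrite expnS; have := lmin l; rewrite ltnn => H.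
  suff : (4 ^ l.+2 <= 32 * n)%N by lia.
  by rewrite leqNgt; apply/negP => /ltnW /H.
have [c [s [cs1 c0 s0 sc zl]]] := small_angle R l.
exists (2 ^ l.+2)%N, c, s; split=> //; last by rewrite zl.
- by rewrite -expnM mulnC expnM.
- by apply/andP; split; nra.
have c1 : c <= 1 by nra.
have -> : c = 1 - (1 - c) by ring.
apply: le_trans (bernoulli n _); last by apply/andP; split; lra.
suff : n%:R * (1 - c) <= 1 / 2 by lra.
have nl : 2 * n%:R <= 4 ^+ l :> R.
  move: hl; rewrite !expnS => hl; rewrite -natrM -natrX ler_nat; lia.
have s2 : s ^+ 2 * 4 ^+ l <= 1.
  have : (s * 2 ^+ l) ^+ 2 <= 1.
    apply: exprn_ile1; first by rewrite mulr_ge0 ?exprn_ge0.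
    rewrite -ler_pdivlMr ?exprn_gt0 // mul1r (le_trans sc) //.
    by rewrite -[leRHS]mulr1 ler_pM2l ?invr_gt0 ?exprn_gt0.
  by rewrite exprMn -exprM mulnC exprM; have -> : (2 ^+ 2 = 4 :> R) by ring.
have h : 1 - c <= s ^+ 2 by nra.
have := ler_wpM2r (sqr_ge0 s) nl.
have := ler_wpM2l (ler0n R n) h.
move: (n%:R) (4 ^+ l) s2 => N F; lra.
Qed.

(** * The XOR lemma *)

Section Blocks.
Variables (n m : nat).

Definition unindex (k : 'I_(n * m)) : 'I_n * 'I_m :=
  enum_val (cast_ord (esym (mxvec_cast n m)) k).

Lemma unindexK i j : unindex (mxvec_index i j) = (i, j).
Proof. by rewrite /unindex /mxvec_index cast_ordK enum_rankK. Qed.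

Lemma mxvec_index_unindex k : mxvec_index (unindex k).1 (unindex k).2 = k.
Proof. by case/mxvec_indexP: k => i j; rewrite unindexK. Qed.

Definition join_blocks (X : 'I_n -> cube m) : cube (n * m) :=
  [ffun k => X (unindex k).1 (unindex k).2].

Lemma block_join X i : block (join_blocks X) i = X i.
Proof. by apply/ffunP => j; rewrite !ffunE unindexK. Qed.

Lemma big_blocks (T : Type) (idx : T) (op : Monoid.com_law idx)
    (F : 'I_(n * m) -> T) :
  \big[op/idx]_k F k = \big[op/idx]_i \big[op/idx]_j F (mxvec_index i j).
Proof.
rewrite pair_bigA /= (reindex (fun p : 'I_n * 'I_m => mxvec_index p.1 p.2)) //=.
exists unindex => [[i j]|k] _ /=; [exact: unindexK | exact: mxvec_index_unindex].
Qed.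

End Blocks.

Section XorLemma.
Variables (R : realType) (n m a : nat) (psi : cube m -> R).
Hypothesis psi_orth : forall g, deg_le a g -> \sum_x psi x * g x = 0.

(* Among n blocks at most L are touched by the factors u, and a monomial of
   degree below (n - L) (a + 1) has degree at most a in some other block. *)
Lemma tensor_orth (L D : nat) (u : 'I_L -> 'I_n -> cube m -> R)
    (g : cube (n * m) -> R) :
  (D < (n - L) * a.+1)%N -> deg_le D g ->
  \sum_(X : {ffun 'I_n -> cube m})
    (\prod_i psi (X i)) * (\prod_j \sum_i u j i (X i)) * g (join_blocks X) = 0.
Proof.
move=> Dn /deg_leP[p [dp pg]].
under eq_bigr do rewrite pg mulr_sumr big_seq.
rewrite exchange_big /= big1 // => mm mmp.
pose bdeg i := (\sum_j mm (mxvec_index i j))%N.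
pose bmon i (x : cube m) : R := \prod_j (x j)%:R ^+ mm (mxvec_index i j).
have monE (X : {ffun 'I_n -> cube m}) : monom R mm (join_blocks X) = \prod_i bmon i (X i).
  rewrite /monom big_blocks; apply: eq_bigr => i _; apply: eq_bigr => j _.
  by rewrite ffunE unindexK.
have dbmon i : deg_le (bdeg i) (bmon i).
  apply: (@deg_le_prod R m _ _ _ (fun j x => (x j)%:R ^+ mm (mxvec_index i j))) => j.
  by apply: deg_leW (deg_leX _ (deg_le_coord R j)); rewrite mul1n.
have mdegE' : mdeg mm = (\sum_i bdeg i)%N by rewrite mdegE big_blocks.
(* Expanding the product of sums gives one term for each map tau from factors to blocks. *)
under eq_bigr => X _.
  rewrite bigA_distr_bigA /= mulrA mulr_sumr mulr_suml mulr_suml; over.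
rewrite exchange_big /= big1 // => tau _.
have [i0 i0tau i0a] : exists2 i0, (forall j, tau j != i0) & (bdeg i0 <= a)%N.
  pose im := [set tau j | j : 'I_L].
  have cim : (#|im| <= L)%N by apply: leq_trans (leq_imset_card _ _) _; rewrite card_ord.
  case: (boolP [exists i in ~: im, (bdeg i <= a)%N]).
    case/existsP => i /andP[]; rewrite inE => iim ia; exists i => // j.
    by apply: contraNneq iim => <-; apply: imset_f.
  (* Otherwise each of the at least n - L untouched blocks has degree at least a + 1, exceeding D in
     total. *)
  move=> /exists_inPn H; exfalso; have := dp _ mmp; rewrite leqNgt => /negP; apply.
  apply: leq_trans Dn _; rewrite mdegE'.
  apply: (@leq_trans (\sum_(i in ~: im) a.+1)).
    by rewrite sum_nat_const leq_mul2r cardsCs setCK card_ord leq_sub2l ?orbT.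
  rewrite big_mkcond /=; apply: leq_sum => i _; case: ifP => // iim.
  by rewrite ltnNge H.
pose F i x := psi x * (\prod_(j | tau j == i) u j (tau j) x) * bmon i x.
transitivity (p@_mm * \sum_(X : {ffun 'I_n -> cube m}) \prod_i F i (X i)).
  rewrite mulr_sumr; apply: eq_bigr => X _; rewrite monE /F !big_split /=.
  have -> : \prod_j u j (tau j) (X (tau j)) =
     \prod_i \prod_(j | tau j == i) u j (tau j) (X i).
    rewrite (partition_big tau predT) //=; apply: eq_bigr => i _.
    by apply: eq_bigr => j /eqP ->.
  by ring.
(* The sum factors over blocks, and its factor at i0 pairs psi with a monomial of degree at most
   a. *)
rewrite -(bigA_distr_bigA F) /= (bigD1 i0) //=.
have -> : \sum_x F i0 x = 0; last by rewrite mul0r mulr0.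
rewrite -[RHS](psi_orth (deg_leW i0a (dbmon i0))); apply: eq_bigr => x _.
rewrite /F big_pred0 ?mulr1 // => j; exact: negbTE.
Qed.

End XorLemma.

Lemma bin_le_exp2 n k : ('C(n, k) <= 2 ^ n)%N.
Proof.
elim: n k => [|n IH] [|k] //; first by rewrite bin0 expn_gt0.
by rewrite binS expnS mul2n -addnn leq_add.
Qed.

Section RootProduct.
Variable R : realType.

(** With k the number of sign errors, the roots 1, .., L erase the points with few but nonzero
    errors. *)
Definition root_prod (L k : nat) : R := \prod_(j < L) (k%:R - j.+1%:R).

Lemma root_prod0 L : root_prod L 0 = (-1) ^+ L * L`!%:R.
Proof.
rewrite /root_prod; elim: L => [|L IH]; first by rewrite big_ord0 expr0 mulr1.
by rewrite big_ord_recr IH factS natrM exprS /=; ring.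
Qed.

Lemma root_prod_eq0 L k : (0 < k <= L)%N -> root_prod L k = 0.
Proof.
case: k => [//|k] /= kL.
by rewrite /root_prod (bigD1 (Ordinal kL)) //= subrr mul0r.
Qed.

(** The product is a falling factorial of k - 1, that is L! times a binomial coefficient. *)
Lemma root_prod_le L k : (L < k)%N -> `|root_prod L k| <= 2 ^+ k * L`!%:R.
Proof.
case: k => [//|k]; rewrite ltnS => Lk.
have -> : root_prod L k.+1 = (k ^_ L)%:R.
  rewrite ffact_prod natr_prod; apply: eq_bigr => j _.
  rewrite -!natr1 natrB; first by ring.
  by apply: leq_trans Lk; apply: ltnW.
rewrite normr_nat -bin_ffact natrM -natrX ler_wpM2r ?ler0n // ler_nat.
by apply: leq_trans (bin_le_exp2 _ _) _; rewrite leq_exp2l.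
Qed.

End RootProduct.

Section XorBound.
Variables (R : realType) (n m a : nat) (h : boolean_fun m) (psi : cube m -> R).

Definition signb (b : bool) : R := if b then 1 else -1.

(** Strictness counts the zeros of psi as correct; they carry no mass. *)
Definition mistake (x : cube m) : bool := psi x * signb (h x) < 0.

Lemma psi_mistake x : psi x = `|psi x| * signb (h x) * (-1) ^+ mistake x.
Proof.
rewrite /mistake /signb; case: (h x); case: ltP => /= H; rewrite ?expr0 ?expr1;
  case: (ger0P (psi x)) => p; lra.
Qed.

Lemma sum_tensor (F : cube m -> R) :
  \sum_(X : {ffun 'I_n -> cube m}) \prod_i F (X i) = (\sum_x F x) ^+ n.
Proof.
rewrite -(bigA_distr_bigA (fun=> F)) /= prodr_const card_ord.
by [].
Qed.

(** The tensor power of psi times [root_prod] of the error count pairs to 0 with Q. Up to the sign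
    (-1)^L, points without errors contribute at least L! tau S0^n, and those with 1 to L errors
    nothing. For the others, weighting each error by 1/delta, as in a Chernoff bound, gains
    delta^(L+1) against a total mass (S0 + S1 / delta)^n <= (2 S0)^n. *)
Lemma xor_bound (L D : nat) (delta tau : R) (Q : cube (n * m) -> R) :
  (forall g, deg_le a g -> \sum_x psi x * g x = 0) ->
  (0 < n)%N -> 0 < delta <= 1 ->
  0 < \sum_x `|psi x| * (~~ mistake x)%:R ->
  \sum_x `|psi x| * (mistake x)%:R
     <= delta * \sum_x `|psi x| * (~~ mistake x)%:R ->
  (D < (n - L) * a.+1)%N -> deg_le D Q -> (forall x, `|Q x| <= 2) ->
  (forall x, tau <= Q x * \prod_(i < n) signb (h (block x i))) ->
  tau <= 2 * 4 ^+ n * delta ^+ L.+1.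
Proof.
set S0 := \sum_x _ * (~~ _)%:R; set S1 := \sum_x _ * (mistake _)%:R.
move=> psi_orth n0 /andP[d0 d1] S00 S1S0 Dn dQ Q2 Qtau.
pose T (X : {ffun 'I_n -> cube m}) := \prod_i `|psi (X i)|.
pose err (x : cube m) : R := if mistake x then delta^-1 else 1.
have nn0 : n%:R != 0 :> R by rewrite pnatr_eq0 -lt0n.
(* Summed over the blocks, the j-th factor is the error count minus j + 1. *)
have := tensor_orth psi_orth
  (fun (j : 'I_L) _ x => (mistake x)%:R - j.+1%:R / n%:R) Dn dQ.
(* The sign (-1)^L makes [root_prod] positive at 0. *)
move=> /(congr1 ( *%R ((-1) ^+ L))); rewrite mulr0 mulr_sumr => sum0.
have pointwise (X : {ffun 'I_n -> cube m}) :
  T X * L`!%:R * (tau * \prod_i (~~ mistake (X i))%:R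
       - 2 * 2 ^+ n * delta ^+ L.+1 * \prod_i err (X i)) <=
  (-1) ^+ L * ((\prod_i psi (X i)) *
    (\prod_(j < L) \sum_(i < n) ((mistake (X i))%:R - j.+1%:R / n%:R)) *
    Q (join_blocks X)).
  pose k := (\sum_i mistake (X i))%N.
  have -> : \prod_(j < L) \sum_(i < n) ((mistake (X i))%:R - j.+1%:R / n%:R)
     = root_prod R L k.
    apply: eq_bigr => j _; rewrite big_split /= -natr_sum; congr (_ + _).
    by rewrite sumr_const card_ord -[LHS]mulr_natr mulNr divfK.
  have psiE : \prod_i psi (X i) = T X * (\prod_i signb (h (X i))) * (-1) ^+ k.
    rewrite expr_sum -!big_split /=; apply: eq_bigr => i _; exact: psi_mistake.
  have T0 : 0 <= T X by apply: prodr_ge0 => i _; apply: normr_ge0.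
  have f0 : 0 <= T X * L`!%:R by rewrite mulr_ge0.
  have err0 : 0 <= \prod_i err (X i).
    by apply: prodr_ge0 => i _; rewrite /err; case: ifP => // _; rewrite invr_ge0 ltW.
  have kn : (k <= n)%N.
    rewrite -[leqRHS]card_ord -sum1_card; apply: leq_sum => i _.
    by case: mistake.
  have c0 : 0 <= 2 * 2 ^+ n * delta ^+ L.+1 * \prod_i err (X i).
    by rewrite !mulr_ge0 ?exprn_ge0 // ltW.
  have sQ := Qtau (join_blocks X).
  rewrite (eq_bigr (fun i => signb (h (X i)))) in sQ; last first.
    by move=> i _; rewrite block_join.
  have [k0|kpos] := posnP k.
    have no i : mistake (X i) = false.
      apply/negbTE; move/eqP: k0; rewrite /k sum_nat_eq0 => /forallP /(_ i).
      by case: mistake.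
    rewrite psiE k0 root_prod0 big1 => [|i _]; last by rewrite no.
    rewrite expr0 !mulr1.
    apply: (@le_trans _ _ (T X * L`!%:R * tau)).
      by rewrite ler_wpM2l // gerBl.
    have -> : (-1) ^+ L * (T X * (\prod_i signb (h (X i))) * ((-1) ^+ L * L`!%:R) *
         Q (join_blocks X))
       = ((-1) ^+ L * (-1) ^+ L) *
         (T X * L`!%:R * (Q (join_blocks X) * \prod_i signb (h (X i)))).
      by move: (\prod_i signb _) => x; ring.
    by rewrite -expr2 sqrr_sign mul1r ler_wpM2l.
  have -> : \prod_i (~~ mistake (X i))%:R = 0 :> R.
    have [i mi] : exists i, mistake (X i).
      apply/existsP; apply: contraLR kpos => /existsPn no.
      by rewrite -eqn0Ngt /k big1 // => i _; rewrite (negbTE (no i)).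
    by rewrite (bigD1 i) //= mi mul0r.
  rewrite mulr0 sub0r; have [kL|Lk] := leqP k L.
    by rewrite root_prod_eq0 ?kpos // mulr0 mul0r mulr0 mulrN oppr_le0 mulr_ge0.
  have errE : \prod_i err (X i) = delta ^- k.
    rewrite /k -exprVn expr_sum; apply: eq_bigr => i _.
    by rewrite /err; case: mistake.
  have big_err : 1 <= delta ^+ L.+1 * \prod_i err (X i).
    rewrite errE ler_pdivlMr ?exprn_gt0 // mul1r.
    by apply: ler_wiXn2l => //; apply: ltW.
  rewrite mulrN lerNl; apply: le_trans (ler_norm _) _.
  rewrite normrN normrM normrX normrN1 expr1n mul1r !normrM psiE !normrM.
  have -> : `|(-1) ^+ k| = 1 :> R by rewrite normrX normrN1 expr1n.
  have -> : `|\prod_i signb (h (X i))| = 1.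
    rewrite normr_prod; apply: big1 => i _.
    by rewrite /signb; case: (h _); rewrite ?normrN ?normr1.
  rewrite !mulr1 ger0_norm //.
  have r1 : `|root_prod R L k| <= 2 ^+ n * L`!%:R.
    apply: le_trans (root_prod_le R Lk) _; rewrite ler_wpM2r //.
    by apply: ler_weXn2l => //; lra.
  apply: (@le_trans _ _ (T X * (2 ^+ n * L`!%:R) * 2)).
    by rewrite ler_pM ?mulr_ge0 // ler_wpM2l.
  have -> : T X * (2 ^+ n * L`!%:R) * 2 = T X * L`!%:R * (2 * 2 ^+ n) * 1 by ring.
  rewrite -!mulrA ler_wpM2l // ler_wpM2l // ler_wpM2l // ler_wpM2l ?exprn_ge0 //.
have : \sum_(X : {ffun 'I_n -> cube m}) T X * L`!%:R *
  (tau * \prod_i (~~ mistake (X i))%:R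
     - 2 * 2 ^+ n * delta ^+ L.+1 * \prod_i err (X i)) <= 0.
  by rewrite -[leRHS]sum0; apply: ler_sum => X _; apply: pointwise.
have -> : \sum_(X : {ffun 'I_n -> cube m}) T X * L`!%:R *
  (tau * \prod_i (~~ mistake (X i))%:R
     - 2 * 2 ^+ n * delta ^+ L.+1 * \prod_i err (X i)) =
  L`!%:R * (tau * S0 ^+ n - 2 * 2 ^+ n * delta ^+ L.+1 * (S0 + S1 / delta) ^+ n).
  have <- : \sum_x `|psi x| * err x = S0 + S1 / delta.
    rewrite /S0 /S1 mulr_suml -big_split /=; apply: eq_bigr => x _.
    by rewrite /err; case: mistake => /=; ring.
  rewrite /S0 -!sum_tensor !mulr_sumr -sumrB mulr_sumr; apply: eq_bigr => X _.
  by rewrite !big_split /= -/(T X); ring.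
rewrite pmulr_rle0 ?ltr0n ?fact_gt0 // subr_le0 => H.
have Sle : (S0 + S1 / delta) ^+ n <= (2 * S0) ^+ n.
  apply: lerXn2r; rewrite ?nnegrE.
  - rewrite addr_ge0 ?(ltW S00) // divr_ge0 ?(ltW d0) //.
    by apply: sumr_ge0 => x _; rewrite mulr_ge0.
  - by rewrite mulr_ge0 // ltW.
  have : S1 / delta <= S0 by rewrite ler_pdivrMr // mulrC.
  lra.
have S0n : 0 < S0 ^+ n by apply: exprn_gt0.
rewrite -(ler_pM2r S0n); apply: (le_trans H).
have -> : (4 : R) = 2 * 2 by ring.
have -> : 2 * (2 * 2) ^+ n * delta ^+ L.+1 * S0 ^+ n
  = 2 * 2 ^+ n * delta ^+ L.+1 * (2 * S0) ^+ n by rewrite !exprMn; ring.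
by apply: ler_wpM2l => //; rewrite !mulr_ge0 ?exprn_ge0 // ltW.
Qed.

End XorBound.

(** * Approximate degree of OR compositions *)

Section Assembly.
Variable R : realType.

Definition mask_blocks (n m : nat) (w : cube m) (a : cube n) (x : cube (n * m)) :
    cube (n * m) :=
  join_blocks (fun i => if a i then block x i else w).

Lemma deg_le_mask n m (w : cube m) a k :
  deg_le 1 (fun x => (@mask_blocks n m w a x k)%:R : R).
Proof.
rewrite /mask_blocks; case ai : (a (unindex k).1).
  apply: deg_le_ext (deg_le_coord R k) => x.
  by rewrite !ffunE ai ffunE mxvec_index_unindex.
apply: deg_le_ext (deg_le_const _ _ (w (unindex k).2)%:R) => x.
by rewrite !ffunE ai.
Qed.

Definition nor_on (n m : nat) (f : boolean_fun m) (a : cube n) :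
    boolean_fun (n * m) :=
  fun x => [forall i, ~~ (a i && f (block x i))].

Lemma bcomp_mask n m (f : boolean_fun m) (w : cube m) (a : cube n) x :
  f w = false -> bcomp (@OR n) f (mask_blocks w a x) = ~~ nor_on f a x.
Proof.
move=> fw; rewrite /bcomp /OR /nor_on; congr (~~ _).
apply/eqP/forallP => [E i|H].
  move/ffunP/(_ i): E; rewrite !ffunE block_join.
  by case: (a i) => //= ->.
apply/ffunP => i; rewrite !ffunE block_join; have := H i.
by case: (a i) => //= /negbTE.
Qed.

Lemma nor_on_disjoint n m (f : boolean_fun m) (a : cube n) x :
  (nor_on f a x)%:R = disjoint_ind R [ffun i => f (block x i)] a.
Proof.
rewrite /nor_on /disjoint_ind; set b := [forall i, _].
have [H|H] := boolP b.
  by rewrite big1 // => i _; rewrite ffunE; move/forallP: H => ->.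
move: H; rewrite /b -negb_exists negbK => /existsP[i ai].
by rewrite (bigD1 i) //= ffunE ai mul0r.
Qed.

(** A term uses t orders of sum at most J, and order k costs degree (k + 1) E. *)
Lemma deg_le_zeno_trunc n N (M : cube n -> cube n -> R)
    (Y : nat -> cube n -> cube N -> R) v0 E t J a :
  (forall k b, deg_le (k.+1 * E) (Y k b)) ->
  deg_le ((J + t) * E) (fun x => zeno_trunc M (fun k b => Y k b x) v0 t J a).
Proof.
move=> dY; elim: t J a => [|t IH] J a; first exact: deg_le_const.
apply: deg_le_sum => k _.
have kJ : (k <= J)%N by rewrite -ltnS.
have -> : ((J + t.+1) * E = k.+1 * E + ((J - k) + t) * E)%N.
  by rewrite -mulnDl; congr (_ * _)%N; lia.
apply: deg_leM; last by apply: deg_le_sum => b _; apply: deg_leZ; apply: IH.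
case: (k : nat) => [|k'] /=; first exact: dY.
apply: deg_leB; first exact: dY.
by apply: deg_leW (dY k' a); rewrite leq_mul2r leqnSn orbT.
Qed.

Lemma parity_polynomial : exists L : nat,
  forall (n m D : nat) (f : boolean_fun m) (w : cube m) (p : cube (n * m) -> R),
    (0 < n)%N -> f w = false -> deg_le D p ->
    (forall x, `|p x - (bcomp (@OR n) f x)%:R| <= 1 / 3) ->
    exists (K : nat) (Q : cube (n * m) -> R),
      [/\ (K ^ 2 <= 128 * n)%N, deg_le (7 * K * (L * D)) Q,
          forall x, `|Q x| <= 2 &
          forall x, 1 / 2 * 2 ^- K <= Q x * \prod_(i < n) signb R (f (block x i))].
Proof.
(* The gap 1/6 is 1/2 - 1/3. *)
have [|L amp] := @amplify R (1 / 6); first lra.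
exists L => n m D f w p n0 fw dp pf.
(* [Y (k, a)] is the query on the set a, amplified to error 4^-k. *)
have /boolp.choice[Y YP] : forall ka : nat * cube n, exists g : cube (n * m) -> R,
    deg_le (ka.1.+1 * (L * D)) g /\
    forall x, `|g x - (nor_on f ka.2 x)%:R| <= 4 ^- ka.1.
  move=> [k a] /=.
  have [||g dg gP] := amp _ D (nor_on f a) (fun x => 1 - p (mask_blocks w a x)) k.
  - apply: deg_leB; first exact: deg_le_const.
    exact: deg_le_comp (deg_le_mask w a) dp.
  - move=> x; have := pf (mask_blocks w a x); rewrite bcomp_mask //.
    rewrite !ler_norml; case: nor_on => /= /andP[? ?]; apply/andP; split; lra.
  - by exists g; split=> //; apply: deg_leW dg; rewrite mulnA [(L * _)%N]mulnC.
have [K [c [s [Kn cs1 /andP[c0 c1] cn zK]]]] := zeno_angle R n0.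
have K0 : (0 < K)%N by case: K zK {Kn} => // /= /eqP; rewrite -subr_eq0 => /eqP; lra.
(* The truncation error 15^K 2^-J is then at most (15/64)^K <= 4^-K, hence at most half of 2^-K. *)
pose J := (6 * K)%N.
pose Q x := zeno_trunc (rotM c s) (fun k b => Y (k, b) x) (@zeros_ind R n) K J
  [ffun=> false].
exists K, Q.
have p2 : 0 < 2 ^- K :> R by rewrite invr_gt0 exprn_gt0.
have p21 : 2 ^- K <= 1 :> R.
  by rewrite invf_le1 ?exprn_gt0 // exprn_ege1 //; lra.
pose ideal x : R := \prod_(i < n) (if f (block x i) then c ^+ K else -1).
have err x : `|ideal x - Q x| <= 1 / 2 * 2 ^- K.
  have YD k a : `|Y (k, a) x - disjoint_ind R [ffun i => f (block x i)] a| <= 4 ^- k.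
    by rewrite -nor_on_disjoint; apply: (YP (k, a)).2.
  (* Testing the norm bound against a basis vector isolates one amplitude. *)
  have unit_delta : \sum_(b : cube n) ((b == [ffun=> false])%:R : R) ^+ 2 <= 1.
    rewrite (bigD1 [ffun=> false]) //= big1 => [|b /negPf ->]; last by rewrite expr0n.
    by rewrite eqxx expr1n addr0.
  have : `|ideal x - Q x| <= (15 ^+ K - 1) * 2 ^- J.
    have := zeno_trunc_error (rotM_orth cs1) K J (disjoint_ind_le1 R _)
      (@norm_le_zeros R n) YD unit_delta.
    rewrite (bigD1 [ffun=> false]) //= [X in _ + X]big1 => [|b /negPf ->]; last first.
      by rewrite mul0r.
    rewrite eqxx -[true%:R]/(1 : R) mul1r addr0 zeno_zeros //.
    by under eq_bigr do rewrite ffunE.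
  move=> /le_trans; apply.
  have -> : 2 ^- J = 64 ^- K :> R.
    by rewrite /J exprM; congr (_ ^- _); ring.
  apply: (@le_trans _ _ (15 ^+ K * 64 ^- K)).
    by rewrite ler_wpM2r ?invr_ge0 ?exprn_ge0 // gerBl.
  rewrite -exprVn -exprMn; apply: (@le_trans _ _ ((1 / 4) ^+ K)).
    by apply: lerXn2r; rewrite ?nnegrE; lra.
  have -> : (1 / 4) ^+ K = 2 ^- K * 2 ^- K :> R.
    by rewrite -exprVn -exprMn; congr (_ ^+ _); field.
  rewrite ler_pM2r //; case: (K) K0 => // k _.
  have : 2 ^- k <= 1 :> R by rewrite invf_le1 ?exprn_gt0 // exprn_ege1 //; lra.
  by rewrite exprS invfM; move: (2 ^- k) => z; lra.
have ideal_le1 x : `|ideal x| <= 1.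
  rewrite /ideal normr_prod; apply: prodr_ile1 => i _; rewrite normr_ge0 /=.
  case: (f _); last by rewrite normrN1.
  by rewrite normrX ger0_norm // exprn_ile1.
have sign1 x : `|\prod_(i < n) signb R (f (block x i))| = 1.
  rewrite normr_prod; apply: big1 => i _.
  by rewrite /signb; case: (f _); rewrite ?normrN1 ?normr1.
have ideal_sign x : 2 ^- K <= ideal x * \prod_(i < n) signb R (f (block x i)).
  (* Each factor becomes c^K or 1, so the product is at least (c^K)^n = (c^n)^K >= 2^-K. *)
  rewrite /ideal -big_split /=.
  have -> : 2 ^- K = (1 / 2) ^+ K :> R by rewrite mul1r exprVn.
  apply: (@le_trans _ _ ((c ^+ n) ^+ K)).
    by apply: lerXn2r; rewrite ?nnegrE ?exprn_ge0 //; lra.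
  rewrite -exprM mulnC exprM -[n in leLHS]card_ord -prodr_const.
  apply: ler_prod => i _; rewrite exprn_ge0 //=.
  by rewrite /signb; case: (f _); rewrite ?mulr1 // mulrNN mulr1 exprn_ile1.
split=> //.
- have -> : (7 * K = J + K)%N by rewrite /J; lia.
  apply: (@deg_le_zeno_trunc n (n * m) (rotM c s) (fun k b => Y (k, b))) => k b.
  exact: (YP (k, b)).1.
- move=> x; have := err x; have := ideal_le1 x; rewrite !ler_norml.
  by move=> /andP[? ?] /andP[? ?]; apply/andP; split; lra.
move=> x; have := ideal_sign x.
have : `|(ideal x - Q x) * \prod_(i < n) signb R (f (block x i))| <= 1 / 2 * 2 ^- K.
  by rewrite normrM sign1 mulr1.
rewrite mulrBl ler_norml => /andP[_].
by move: (ideal x * _) (Q x * _) => y z; lra.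
Qed.

End Assembly.

(** K^2 <= 128 n gives K <= 12 n, and the exponent 34 (n./2 + 1) >= 17 (n + 1) exceeds (2n + 1) +
    (12n + 1). *)
Lemma small_delta (R : realType) (n K : nat) : (0 < n)%N -> (K ^ 2 <= 128 * n)%N ->
  2 * 4 ^+ n * (2 ^- 34) ^+ (n./2).+1 < 1 / 2 * 2 ^- K :> R.
Proof.
move=> n0 Kn.
have K12 : (K <= 12 * n)%N.
  by rewrite -(@leq_exp2r _ _ 2) // (leq_trans Kn) // expnMn; nia.
have n2 := odd_double_half n.
have -> : (4 : R) = 2 ^+ 2 by ring.
rewrite exprVn -!exprM -exprS ltr_pdivrMr ?exprn_gt0 //.
have -> : 1 / 2 * 2 ^- K = 2 ^- K.+1 :> R by rewrite exprS invfM mul1r.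
rewrite mulrC ltr_pdivlMr ?exprn_gt0 // -exprD.
rewrite ltr_eXn2l; last by lra.
by move: n2; rewrite -muln2; case: odd => /=; lia.
Qed.

(** Duality at error 1/2 - delta/4. As psi is orthogonal to constants, its correlation with f is
    half that with the signs of f, namely (S0 - S1) / 2; exceeding (1/2 - delta/4)(S0 + S1) forces
    S1 < (delta/2) S0. *)
Lemma dual_polynomial (R : realType) (m a : nat) (f : boolean_fun m) (delta : R) :
  0 < delta -> delta <= 1 ->
  (forall g, deg_le a g -> ~ (forall x, `|g x - (f x)%:R| <= 1 / 2 - delta / 4)) ->
  exists psi : cube m -> R,
    [/\ forall g, deg_le a g -> \sum_x psi x * g x = 0,
        0 < \sum_x `|psi x| * (~~ mistake f psi x)%:R &
        \sum_x `|psi x| * (mistake f psi x)%:R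
          <= delta * \sum_x `|psi x| * (~~ mistake f psi x)%:R].
Proof.
move=> d0 d1 nog.
have [|[co coP]|[psi [orth corr]]] := @sup_duality R (cube m) 'X_{1..m < a.+1}
  (fun mm x => monom R mm x) (fun x => (f x)%:R) (1 / 2 - delta / 4).
- lra.
- exfalso; apply: nog coP; apply: deg_le_sum => mm _; apply: deg_leZ.
  by apply: deg_leW (deg_le_monom R mm); rewrite -ltnS bmdeg.
have psi_orth g : deg_le a g -> \sum_x psi x * g x = 0.
  move=> /deg_leP[p [dp pg]]; under eq_bigr do rewrite pg mulr_sumr big_seq.
  rewrite exchange_big /= big1 // => mm mmp.
  have mma : (mdeg mm < a.+1)%N by rewrite ltnS dp.
  transitivity (p@_mm * \sum_x psi x * monom R mm x).
    by rewrite mulr_sumr; apply: eq_bigr => x _; ring.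
  by rewrite (orth (BMultinom mma)) mulr0.
exists psi; move: (psi_orth _ (deg_le_const _ _ 1)).
set S0 := \sum_x _ * (~~ _)%:R; set S1 := \sum_x _ * (mistake _ _ _)%:R => sum0.
have S1_ge0 : 0 <= S1 by apply: sumr_ge0 => x _; rewrite mulr_ge0.
have normE : \sum_x `|psi x| = S0 + S1.
  by rewrite /S0 /S1 -big_split /=; apply: eq_bigr => x _; case: mistake => /=; ring.
have corrE : \sum_x psi x * (f x)%:R = (S0 - S1) / 2.
  suff E : (\sum_x psi x * (f x)%:R) * 2 = S0 - S1 by lra.
  rewrite mulr_suml.
  rewrite -[LHS](subr0 _) -[X in _ - X = _]sum0 /S0 /S1 -!sumrB; apply: eq_bigr => x _.
  rewrite {1 2}(psi_mistake f psi x) /signb.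
  by case: (f x); case: mistake => /=; rewrite ?expr0 ?expr1; ring.
have S1S0 : S1 < delta / 2 * S0 by rewrite normE corrE in corr; nra.
by split=> //; nra.
Qed.

Theorem theorem1 (R : realType) :
  exists c : R, 0 < c /\
    forall (n m : nat) (f : boolean_fun m), (0 < n)%N -> (0 < m)%N ->
      c * Num.sqrt (n%:R) * (approx_degree R f)%:R
        <= (approx_degree R (bcomp (@OR n) f))%:R.
Proof.
have [L1 parity] := parity_polynomial R.
pose delta : R := 2 ^- 34.
have d0 : 0 < delta by rewrite invr_gt0 exprn_gt0.
have d1 : delta <= 1 by rewrite invf_le1 ?exprn_gt0 // exprn_ege1 //; lra.
have [|L2 amp] := @amplify R (delta / 4); first lra.
(* Amplifying with k = 1 multiplies degrees by 2 L2 and leaves error 1/4. So degree a, with a M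
   below the approximate degree of f, does not even allow error 1/2 - delta/4. *)
pose M := (2 * L2).+1.
(* 168 is 14 * 12, from 2 * 7 in the degree count and K <= 12 sqrt n; the successor keeps C
   positive. *)
pose C : R := (168 * M * L1).+1%:R.
have C0 : 0 < C by rewrite ltr0n.
exists C^-1; split=> [|n m f n0 m0]; first by rewrite invr_gt0.
set D := approx_degree R (bcomp _ _).
have [->|d_gt0] := posnP (approx_degree R f); first by rewrite mulr0.
(* If f is constantly 1, its approximate degree is 0. *)
have [w fw] : exists w, f w = false.
  case: (boolP [exists w, ~~ f w]) => [/existsP[w /negbTE fw]|]; first by exists w.
  rewrite negb_exists => /forallP f1; move: d_gt0; rewrite ltnNge => /negP[].
  apply: (approx_degree_le (deg_le_const _ _ 1)) => x.
  by have := f1 x; rewrite negbK => ->; rewrite subrr normr0; lra.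
have [p dp pf] := approx_degreeP R (bcomp (@OR n) f).
have [K [Q [Kn dQ Q2 Qsign]]] := parity n m D f w p n0 fw dp pf.
pose a := ((approx_degree R f).-1 %/ M)%N.
have Ma : (a * M <= (approx_degree R f).-1)%N by apply: leq_divM.
have aM : (approx_degree R f <= a.+1 * M)%N.
  by have := ltn_ceil (approx_degree R f).-1 (ltn0Sn (2 * L2)); rewrite -/M -/a; lia.
have [|psi [psi_orth S0 S1]] := dual_polynomial d0 d1 (a := a) (f := f).
  move=> g dg gf; have [g' dg' g'f] := amp _ _ f g 1%N dg gf.
  have : (approx_degree R f <= L2 * 2 * a)%N.
    apply: (approx_degree_le dg') => x; apply: le_trans (g'f x) _.
    by rewrite expr1; lra.
  by move: Ma; rewrite /M; nia.
(* Otherwise [xor_bound] with L = n./2 contradicts [small_delta]. *)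
have degQ : ((n - n./2) * a.+1 <= 7 * K * (L1 * D))%N.
  rewrite leqNgt; apply/negP => lt.
  have := xor_bound psi_orth n0 _ S0 S1 lt dQ Q2 Qsign.
  by rewrite d0 d1 leNgt small_delta // => /(_ isT).
have nat_bound : (n * approx_degree R f <= 14 * M * L1 * D * K)%N.
  have n2 : (n <= 2 * (n - n./2))%N by have := odd_double_half n; rewrite -muln2; lia.
  apply: (@leq_trans (2 * (n - n./2) * (a.+1 * M))%N); first exact: leq_mul.
  have -> : (2 * (n - n./2) * (a.+1 * M) = 2 * M * ((n - n./2) * a.+1))%N by ring.
  have -> : (14 * M * L1 * D * K = 2 * M * (7 * K * (L1 * D)))%N by ring.
  by rewrite leq_mul2l degQ orbT.
have sn0 : 0 < Num.sqrt n%:R :> R by rewrite sqrtr_gt0 ltr0n.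
have sn2 : Num.sqrt n%:R ^+ 2 = n%:R :> R by rewrite sqr_sqrtr.
have Ks : K%:R <= 12 * Num.sqrt n%:R :> R.
  rewrite -(@ler_pXn2r _ 2) ?nnegrE ?mulr_ge0 // ?(ltW sn0) // exprMn sn2.
  have : (K ^ 2)%:R <= (128 * n)%:R :> R by rewrite ler_nat.
  rewrite natrX natrM; have : 0 <= n%:R :> R by [].
  move: (n%:R) (K%:R ^+ 2) => x y; lra.
rewrite -mulrA ler_pdivrMl // -(ler_pM2l sn0) mulrA -expr2 sn2.
move: nat_bound; rewrite -(ler_nat R) natrM => /le_trans; apply.
rewrite natrM; apply: (@le_trans _ _ ((14 * M * L1 * D)%:R * (12 * Num.sqrt n%:R))).
  by rewrite ler_wpM2l.
rewrite mulrA [leLHS]mulrC ler_pM2l // -!natrM ler_nat.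
have -> : ((168 * M * L1).+1 * D = 14 * M * L1 * D * 12 + D)%N by ring.
exact: leq_addr.
Qed.
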